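(* For every dimension $d\ge 3$ there exists a constant $c=c(d)>0$ such that for every positive integer $N$ and all point sets $\mathcal{P}_N\subset[0,1)^d$ with $N$ points we have $$\left\|D_{\mathcal{P}_N}\,\middle|\,\mathrm{BMO}^d\right\|\ge c\,(\log N)^{(d-1)/2}.$$
   Context: Discrepancy function: for a point set $\mathcal{P}_N\subset[0,1)^d$ with $N$ points and $x=(x_1,\ldots,x_d)\in[0,1)^d$, $$D_{\mathcal{P}_N}(x)=\sum_{z\in\mathcal{P}_N}\chi_{[0,x)}(z)-N x_1\cdots x_d,$$ where $[0,x)=[0,x_1)\times\cdots\times[0,x_d)$ and $\chi_A$ is the characteristic function of $A$. Dyadic intervals and Haar functions: for $j\in\mathbb{N}_0=\{0,1,2,\ldots\}$ let $\mathbb{D}_j=\{0,1,\ldots,2^j-1\}$, and for $m\in\mathbb{D}_j$ let $I_{j,m}=[2^{-j}m,2^{-j}(m+1))$. Let $h_{j,m}:[0,1)\to\mathbb{R}$ be supported in $I_{j,m}$, equal to $1$ on the left half $I_{j+1,2m}$ of $I_{j,m}$ and $-1$ on the right half $I_{j+1,2m+1}$. For $j=(j_1,\ldots,j_d)\in\mathbb{N}_0^d$ and $m=(m_1,\ldots,m_d)\in\mathbb{D}_j:=\mathbb{D}_{j_1}\times\cdots\times\mathbb{D}_{j_d}$ let $|j|=j_1+\cdots+j_d$, $I_{j,m}=I_{j_1,m_1}\times\cdots\times I_{j_d,m_d}$ and $h_{j,m}(x)=h_{j_1,m_1}(x_1)\cdots h_{j_d,m_d}(x_d)$. (Haar functions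 are normalized in $L_\infty$.) Dyadic product BMO (semi)norm: for an integrable function $f$ on $[0,1)^d$, $$\left\|f\,\middle|\,\mathrm{BMO}^d\right\|=\sup_{U\subset[0,1)^d}\left(|U|^{-1}\sum_{j\in\mathbb{N}_0^d}2^{|j|}\sum_{\substack{m\in\mathbb{D}_j\\ I_{j,m}\subset U}}|\langle f,h_{j,m}\rangle|^2\right)^{1/2},$$ where the supremum is over all measurable sets $U\subset[0,1)^d$ (of positive Lebesgue measure $|U|$) and $\langle f,g\rangle=\int_{[0,1)^d}f g\,dx$. *)

(* Defs.v *)
From HB Require Import structures.
From mathcomp Require Import all_boot all_order all_algebra finmap.
From mathcomp Require Import all_classical all_reals all_analysis.

Set Implicit Arguments.
Unset Strict Implicit.
Unset Printing Implicit Defensive.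

Import Order.TTheory GRing.Theory Num.Theory.
Import numFieldNormedType.Exports.

Local Open Scope classical_set_scope.
Local Open Scope ring_scope.

Notation euclid R d := (d.-tuple (measurableTypeR R)).

Section lebesgue_euclid.
Variable R : realType.

Definition consT d (xy : measurableTypeR R * euclid R d) : euclid R d.+1 :=
  [tuple of xy.1 :: xy.2].

Definition unconsT d (t : euclid R d.+1) : measurableTypeR R * euclid R d :=
  (thead t, [tuple of behead t]).

Lemma consTK d : cancel (@consT d) (@unconsT d).
Proof.
case=> x y; rewrite /unconsT /consT theadE; congr pair.
by apply: val_inj.
Qed.

Lemma measurable_consT d : measurable_fun [set: _] (@consT d).
Proof. exact: measurable_cons. Qed.

Lemma measurable_unconsT d : measurable_fun [set: _] (@unconsT d).
Proof.
apply/measurable_fun_pairP; split.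
  exact: (@measurable_tnth _ (measurableTypeR R) d.+1 ord0).
exact: measurable_behead.
Qed.

Section step.
Variables (d : nat) (mu : {sigma_finite_measure set (euclid R d) -> \bar R}).

Definition lebesgue_step : set (euclid R d.+1) -> \bar R :=
  pushforward (lebesgue_measure \x mu)%E (@consT d).

Let pushforward_measure : {measure set (euclid R d.+1) -> \bar R} :=
  measure_function_pushforward__canonical__measure_function_Measure
    (lebesgue_measure \x mu)%E (measurable_consT (d := d)).

Let lebesgue_step0 : lebesgue_step set0 = 0%E.
Proof. exact: (measure0 pushforward_measure). Qed.

Let lebesgue_step_ge0 A : (0 <= lebesgue_step A)%E.
Proof. exact: (measure_ge0 pushforward_measure). Qed.

Let lebesgue_step_sigma_additive : semi_sigma_additive lebesgue_step.
Proof. exact: (@measure_semi_sigma_additive _ _ _ pushforward_measure). Qed.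

HB.instance Definition _ := isMeasure.Build _ _ _ lebesgue_step
  lebesgue_step0 lebesgue_step_ge0 lebesgue_step_sigma_additive.

Let lebesgue_step_sigma_finite : sigma_finite [set: _] lebesgue_step.
Proof.
have /sigma_finiteP[F [TF ndF Foo]] := sigma_finiteT (@lebesgue_measure R).
have /sigma_finiteP[G [TG ndG Goo]] := sigma_finiteT mu.
exists (fun n => @unconsT d @^-1` (F n `*` G n)).
  rewrite -preimage_bigcup; apply/seteqP; split => // t _.
  have [n _ Fn] : (\bigcup_i F i) (unconsT t).1 by rewrite -TF.
  have [k _ Gk] : (\bigcup_i G i) (unconsT t).2 by rewrite -TG.
  exists (maxn n k) => //; split.
    by move: Fn; exact/subsetPset/ndF/leq_maxl.
  by move: Gk; exact/subsetPset/ndG/leq_maxr.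
move=> n; have [mF Fn] := Foo n; have [mG Gn] := Goo n; split.
  rewrite -[X in measurable X]setTI; apply: measurable_unconsT => //.
  exact: measurableX.
rewrite /lebesgue_step /pushforward -comp_preimage.
rewrite (_ : _ \o _ = id); last by apply/funext => xy; exact: consTK.
by rewrite preimage_id product_measure1E// lte_mul_pinfty// ge0_fin_numE.
Qed.

HB.instance Definition _ := Measure_isSigmaFinite.Build _ _ _ lebesgue_step
  lebesgue_step_sigma_finite.
End step.

Fixpoint lebesgue_euclid d : {sigma_finite_measure set (euclid R d) -> \bar R} :=
  if d is d'.+1 then lebesgue_step (lebesgue_euclid d')
  else \d_([tuple] : euclid R 0).

(* This property characterizes the recursively defined measure above as
   Lebesgue measure on R^d. *)
Lemma lebesgue_euclid_box d (A : 'I_d -> set (measurableTypeR R)) :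
  (forall i, measurable (A i)) ->
  lebesgue_euclid d [set x | forall i, A i (tnth x i)] =
  (\prod_(i < d) lebesgue_measure (A i))%E.
Proof.
elim: d A => [|d IH] A mA.
  by rewrite big_ord0 /= diracE mem_set// => -[].
rewrite big_ord_recl -IH//= /lebesgue_step /pushforward.
set B := [set x : euclid R d | _].
rewrite -product_measure1E//.
  congr (product_measure1 _ _ _); apply/seteqP; split => -[x y] /=.
    move=> Axy; split; first by have := Axy ord0.
    by move=> i; have := Axy (lift ord0 i); rewrite tnthS.
  move=> [Ax By] i; case: (unliftP ord0 i) => [j ->|->]//.
  by rewrite tnthS; exact: By.
rewrite (_ : B = \bigcap_(i in [set: 'I_d])
    ((fun x : euclid R d => tnth x i) @^-1` A (lift ord0 i))).
  apply: fin_bigcap_measurable => // i _.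
  by rewrite -[X in measurable X]setTI; exact: measurable_tnth.
by apply/seteqP; split => x Bx i => [_|]; exact: Bx.
Qed.

End lebesgue_euclid.

Section discrepancy.
Variables (R : realType) (d : nat).
Implicit Types (x z : euclid R d) (f g : euclid R d -> R).
Implicit Types (j m : d.-tuple nat).

Definition unit_cube : set (euclid R d) :=
  [set x | forall i, `[0, 1[%classic (tnth x i : R)].

Definition corner_box x : set (euclid R d) :=
  [set z | forall i, `[0, tnth x i[%classic (tnth z i : R)].

Definition discrepancy (P : {fset euclid R d}) x : R :=
  \sum_(z <- P) \1_(corner_box x) z -
  #|` P|%fset%:R * \prod_(i < d) (tnth x i : R).

Definition haar_itv (j m : nat) : set R :=
  `[m%:R / 2 ^+ j, m.+1%:R / 2 ^+ j[%classic.

Definition haar1 (j m : nat) (t : R) : R :=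
  \1_(haar_itv j.+1 m.*2) t - \1_(haar_itv j.+1 m.*2.+1) t.

Definition dyadic_index j : set (d.-tuple nat) :=
  [set m | forall i, (tnth m i < 2 ^ tnth j i)%N].

Definition dyadic_box j m : set (euclid R d) :=
  [set x | forall i, haar_itv (tnth j i) (tnth m i) (tnth x i)].

Definition haar j m x : R :=
  \prod_(i < d) haar1 (tnth j i) (tnth m i) (tnth x i).

Definition inner_cube f g : R :=
  \int[@lebesgue_euclid R d]_(x in unit_cube) (f x * g x).

(* The value for one set U; \bar R-valued since nothing bounds the sum for a
   general integrable f. *)
Definition bmo_at f (U : set (euclid R d)) : \bar R :=
  (((lebesgue_euclid R d U)^-1 *
    \esum_(j in [set: d.-tuple nat])
      ((2 ^+ (\sum_(i < d) tnth j i)%N)%:E *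
       \esum_(m in [set m | dyadic_index j m /\ dyadic_box j m `<=` U])
         (`|inner_cube f (haar j m)| ^+ 2)%:E)) `^ 2^-1)%E.

Definition bmo_norm f : \bar R :=
  ereal_sup [set bmo_at f U | U in
    [set U | [/\ measurable U, U `<=` unit_cube
                & (0 < lebesgue_euclid R d U)%E]]].

End discrepancy.

(* Main.v *)
Require Import Defs.
From mathcomp Require Import all_boot all_order all_algebra finmap.
From mathcomp Require Import all_classical all_reals all_analysis.
From mathcomp Require Import measurable_realfun zify ring lra.

Set Implicit Arguments.
Unset Strict Implicit.
Unset Printing Implicit Defensive.

Import Order.TTheory GRing.Theory Num.Theory.
Import numFieldNormedType.Exports.

Local Open Scope classical_set_scope.
Local Open Scope ring_scope.

(** The bound already holds for the single test set U = [0,1)^d, and only one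
    scale of Haar coefficients is needed. Let 2^n lie between 2N and 4N.

    For each shape j with |j| = n the 2^n boxes I_{j,m} are disjoint, so at
    least half of them contain no point of P ([card_free_boxes]). On such a
    box the counting part of the discrepancy has zero Haar coefficient: in some
    coordinate i the point lies to the left or to the right of the interval, so
    that the indicator of x_i > z_i is constant on the support of the
    mean-zero function h_{j_i,m_i} ([integral_ray_haar1]). What remains is the
    coefficient of -N x_1 ... x_d, which factors over the coordinates and has
    absolute value N 4^-(n+d) ([inner_cube_empty_box]).

    Hence each shape contributes at least
      2^n * (2^n / 2) * N^2 * 16^-(n+d) = (N / 2^n)^2 / (2 * 16^d)
                                       >= 1 / (32 * 16^d)
    to the square of the norm ([esum_shape_ge]). There are C(n+d-1, d-1) shapes
    with |j| = n, which is at least n^(d-1) / (d-1)!, and n >= ln N; taking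
    square roots gives the exponent (d-1)/2. *)

(** * Integrals of products of one-variable functions *)

Section tensor.
Variable R : realType.
Local Notation mu := (@lebesgue_measure R).

Lemma integrable_tensor2 d1 d2 (T1 : measurableType d1) (T2 : measurableType d2)
    (m1 : {sigma_finite_measure set T1 -> \bar R})
    (m2 : {sigma_finite_measure set T2 -> \bar R}) (f : T1 -> R) (g : T2 -> R) :
  m1.-integrable setT (EFin \o f) -> m2.-integrable setT (EFin \o g) ->
  (m1 \x m2)%E.-integrable setT (EFin \o (fun z => f z.1 * g z.2)) /\
  (\int[(m1 \x m2)%E]_z (f z.1 * g z.2) =
   \int[m1]_x f x * \int[m2]_y g y)%R.
Proof.
move=> fi gi.
have /measurable_EFinP mf := measurable_int _ fi.
have /measurable_EFinP mg := measurable_int _ gi.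
have mfg : measurable_fun setT (EFin \o (fun z : T1 * T2 => f z.1 * g z.2)).
  apply/measurable_EFinP/measurable_funM.
    exact: measurableT_comp mf measurable_fst.
  exact: measurableT_comp mg measurable_snd.
have fg_int : (m1 \x m2)%E.-integrable setT (EFin \o (fun z => f z.1 * g z.2)).
  apply/(integrable12ltyP _ _ mfg).
  have /integrableP[_ fy] := fi; have /integrableP[mag gy] := gi.
  have -> : (\int[m1]_x \int[m2]_y `|(f x * g y)%:E| =
    \int[m1]_x `|(f x)%:E| * \int[m2]_y `|(g y)%:E|)%E.
    rewrite -ge0_integralZr//.
    - apply: eq_integral => x _; rewrite -ge0_integralZl//.
      + by apply: eq_integral => y _; rewrite /= normrM EFinM.
      + exact: measurableT_comp.
    - by apply: measurableT_comp => //; exact/measurable_EFinP.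
    - by apply: integral_ge0.
  by rewrite lte_mul_pinfty// ?integral_ge0// ge0_fin_numE// integral_ge0.
split=> //.
have gf := integrable_fin_num measurableT gi.
have ff := integrable_fin_num measurableT fi.
rewrite /Rintegral -fineM//; congr fine.
rewrite -(integral12_prod_meas1 fg_int).
rewrite -(fineK gf) -(integralZr measurableT fi); apply: eq_integral => x _.
by rewrite fineK// -(integralZl measurableT gi).
Qed.

(** The measure in dimension d+1 is the image of a product measure under
    [consT], so a change of variables reduces the product of d+1 factors to the
    two-factor case. *)
Lemma integrable_tensor d (f : 'I_d -> R -> R) :
  (forall i, mu.-integrable setT (EFin \o f i)) ->
  (lebesgue_euclid R d).-integrable setT
    (EFin \o (fun x => \prod_(i < d) f i (tnth x i))) /\
  \int[lebesgue_euclid R d]_x (\prod_(i < d) f i (tnth x i)) =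
  \prod_(i < d) \int[mu]_t f i t.
Proof.
elim: d f => [|d IH] f fi.
  have E (x : euclid R 0) : \prod_(i < 0) f i (tnth x i) = 1 by exact: big_ord0.
  split.
    apply: (eq_integrable _ (cst 1%:E)) => //; first by move=> x _; rewrite /= E.
    exact: finite_measure_integrable_cst.
  under eq_Rintegral do rewrite E.
  rewrite Rintegral_cst//= /dirac indicT mulr1.
  by rewrite big_ord0.
have [gi gE] := IH (fun i => f (lift ord0 i)) (fun i => fi _).
have [fgi fgE] := integrable_tensor2 (fi ord0) gi.
pose F (x : euclid R d.+1) := \prod_(i < d.+1) f i (tnth x i).
have mF : measurable_fun setT (EFin \o F).
  apply/measurable_EFinP/measurable_prod => i _.
  have /measurable_EFinP mf := measurable_int _ (fi i).
  exact: measurableT_comp mf (measurable_tnth i).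
have FE : EFin \o (fun z => f ord0 z.1 *
    \prod_(i < d) f (lift ord0 i) (tnth z.2 i)) = (EFin \o F) \o @consT R d.
  apply/funext => -[x y]; rewrite /= /F big_ord_recl; congr (_ * _)%:E.
  by apply: eq_bigr => i _; rewrite tnthS.
split.
  apply: (@integrable_pushforward _ _ _ _ _ _ (@measurable_consT R d)) => //.
  by rewrite preimage_setT -FE.
rewrite big_ord_recl -gE -fgE /Rintegral; congr fine.
rewrite (@integral_pushforward _ _ _ _ _ _ (@measurable_consT R d)
  (mu \x lebesgue_euclid R d)%E setT (EFin \o F))//; last first.
  by rewrite preimage_setT -FE.
by rewrite preimage_setT -FE.
Qed.

(** Cutting off to the cube acts coordinatewise, which lets an integral over the
    cube be read as the full-space integral of a product of cut-off factors. *)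
Lemma restrict_unit_cube d (f : 'I_d -> R -> R) :
  ((fun x => \prod_(i < d) f i (tnth x i)) : euclid R d -> R) \_ (@unit_cube R d) =
  (fun x : euclid R d => \prod_(i < d) (f i \_ `[0%R, 1%R[) (tnth x i)).
Proof.
apply/funext => x; rewrite patchE; case: ifPn => [|].
  rewrite inE => xU; apply: eq_bigr => i _; rewrite patchE mem_set//.
rewrite notin_setE => /existsNP[i xi].
by rewrite (bigD1 i)//= patchE memNset// mul0r.
Qed.

Lemma measurable_unit_cube d : measurable (@unit_cube R d).
Proof.
rewrite (_ : unit_cube (d:=d) = \bigcap_(i in [set: 'I_d])
    ((fun x : euclid R d => tnth x i) @^-1` `[0, 1[)).
  apply: fin_bigcap_measurable => // i _.
  by rewrite -[X in measurable X]setTI; exact: measurable_tnth.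
by apply/seteqP; split => x Bx i => [_|]; exact: Bx.
Qed.

Lemma lebesgue_unit_cube d : lebesgue_euclid R d (@unit_cube R d) = 1%E.
Proof.
transitivity (\prod_(i < d) mu `[0%R, 1%R[)%E.
  exact: (@lebesgue_euclid_box R d (fun=> `[0%R, 1%R[%classic)).
rewrite big1// => i _.
by rewrite lebesgue_measure_itv/= lte_fin ltr01 oppr0 adde0.
Qed.

Lemma integrable_cube_prod d (f : 'I_d -> R -> R) :
  (forall i, mu.-integrable `[0%R, 1%R[ (EFin \o f i)) ->
  (lebesgue_euclid R d).-integrable (@unit_cube R d)
    (EFin \o (fun x => \prod_(i < d) f i (tnth x i))) /\
  \int[lebesgue_euclid R d]_(x in @unit_cube R d)
     (\prod_(i < d) f i (tnth x i)) =
  \prod_(i < d) \int[mu]_(t in `[0%R, 1%R[) f i t.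
Proof.
move=> fi.
have /integrable_tensor[] : forall i,
    mu.-integrable setT (EFin \o (f i \_ `[0%R, 1%R[)).
  move=> i; rewrite -restrict_EFin.
  by apply: (integrable_mkcond _ _).1.
rewrite -restrict_unit_cube -restrict_EFin => gi gE; split.
  exact/(integrable_mkcond _ (@measurable_unit_cube d)).
rewrite Rintegral_mkcond gE; apply: eq_bigr => i _.
by rewrite -Rintegral_mkcond.
Qed.

End tensor.

(** * Integrals against a one-dimensional Haar function *)

Section haar1D.
Variable R : realType.
Local Notation mu := (@lebesgue_measure R).

Lemma haar_itv_sub01 j m : (m < 2 ^ j)%N ->
  @haar_itv R j m `<=` `[0%R, 1%R[.
Proof.
move=> mj t; rewrite /haar_itv /= !in_itv/= => /andP[mt tm].
rewrite (le_trans _ mt) ?divr_ge0 ?exprn_ge0//=.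
by rewrite (lt_le_trans tm)// ler_pdivrMr ?exprn_gt0// mul1r -natrX ler_nat.
Qed.

Lemma haar_itv_bisect j m :
  let h : R := (2 ^+ j.+1)^-1 in let a := m%:R / 2 ^+ j in
  [/\ @haar_itv R j m = `[a, a + h + h[%classic,
      @haar_itv R j.+1 m.*2 = `[a, a + h[%classic &
      @haar_itv R j.+1 m.*2.+1 = `[a + h, a + h + h[%classic ].
Proof.
move=> h a.
have hE : 2 ^+ j = (2 * h)^-1 :> R.
  by rewrite /h exprS invfM invrK mulrA mulVf ?mul1r// pnatr_eq0.
have h0 : h != 0 by rewrite invr_eq0 expf_neq0// pnatr_eq0.
have e1 : m.+1%:R * (2 * h) = m%:R * (2 * h) + h + h by rewrite -addn1 natrD; ring.
have e2 : m.*2%:R * h = m%:R * (2 * h) by rewrite -mul2n natrM; ring.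
have e3 : m.*2.+1%:R * h = m%:R * (2 * h) + h by rewrite -addn1 natrD mulrDl e2 mul1r.
have e4 : m.*2.+2%:R * h = m%:R * (2 * h) + h + h.
  by rewrite -addn1 natrD mulrDl e3 mul1r.
by rewrite /haar_itv -/h /a hE invrK e1 e2 e3 e4.
Qed.

Lemma haar_itv_left j m : @haar_itv R j.+1 m.*2 `<=` @haar_itv R j m.
Proof.
have [-> -> _] := haar_itv_bisect j m.
have h0 : 0 < (2 ^+ j.+1 : R)^-1 by rewrite invr_gt0 exprn_gt0.
by move=> t /=; rewrite !in_itv/= => /andP[-> th] /=; lra.
Qed.

Lemma haar_itv_right j m : @haar_itv R j.+1 m.*2.+1 `<=` @haar_itv R j m.
Proof.
have [-> _ ->] := haar_itv_bisect j m.
have h0 : 0 < (2 ^+ j.+1 : R)^-1 by rewrite invr_gt0 exprn_gt0.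
by move=> t /=; rewrite !in_itv/= => /andP[th ->]; rewrite andbT; lra.
Qed.

Lemma integral_haar1 j m (g : R -> R) : (m < 2 ^ j)%N ->
  mu.-integrable `[0%R, 1%R[ (EFin \o g) ->
  mu.-integrable `[0%R, 1%R[ (EFin \o (fun t => g t * haar1 j m t)) /\
  \int[mu]_(t in `[0%R, 1%R[) (g t * haar1 j m t) =
  \int[mu]_(t in @haar_itv R j.+1 m.*2) g t -
  \int[mu]_(t in @haar_itv R j.+1 m.*2.+1) g t.
Proof.
move=> mj gi.
have L01 := subset_trans (@haar_itv_left j m) (haar_itv_sub01 mj).
have R01 := subset_trans (@haar_itv_right j m) (haar_itv_sub01 mj).
set L := @haar_itv R j.+1 m.*2 in L01 *.
set Q := @haar_itv R j.+1 m.*2.+1 in R01 *.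
have E : (fun t => g t * haar1 j m t) = (fun t => (g \_ L) t - (g \_ Q) t).
  by apply/funext => t; rewrite !patch_indic /haar1 /= mulrBr.
have restr (A : set (measurableTypeR R)) : measurable A -> A `<=` `[0%R, 1%R[ ->
    mu.-integrable `[0%R, 1%R[ (EFin \o (g \_ A)).
  move=> mA A01; rewrite -restrict_EFin.
  apply: (integrable_restrict mu mA _ _).1 => //.
  by apply: integrableS gi => //; exact: measurableI.
have Li := restr _ (measurable_itv _) L01.
have Qi := restr _ (measurable_itv _) R01.
have m01 : measurable (`[0%R, 1%R[%classic : set (measurableTypeR R)).
  exact: measurable_itv.
rewrite E; split; first exact: (integrableB m01 Li Qi).
rewrite RintegralB// -!Rintegral_mkcondr; congr (_ - _).
  by rewrite setIidr.
by rewrite setIidr.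
Qed.

(** The two halves of a dyadic interval have equal length, so a Haar function
    annihilates whatever is constant on its support. *)
Lemma integral_haar1_cst j m (g : R -> R) k : (m < 2 ^ j)%N ->
  mu.-integrable `[0%R, 1%R[ (EFin \o g) ->
  (forall t, @haar_itv R j m t -> g t = k) ->
  \int[mu]_(t in `[0%R, 1%R[) (g t * haar1 j m t) = 0.
Proof.
move=> mj gi gk; rewrite (integral_haar1 mj gi).2.
under eq_Rintegral => t /set_mem tL do rewrite (gk t (haar_itv_left tL)).
under [X in _ - X]eq_Rintegral => t /set_mem tQ
  do rewrite (gk t (haar_itv_right tQ)).
rewrite !Rintegral_cst//; try exact: measurable_itv.
have [_ -> ->] := haar_itv_bisect j m.
have h0 : 0 < (2 ^+ j.+1 : R)^-1 by rewrite invr_gt0 exprn_gt0.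
rewrite /= !lebesgue_measure_itv /= !lte_fin !ltrDl h0 /=.
by ring.
Qed.

Lemma Rintegral_id (a b : R) : a < b ->
  \int[mu]_(t in `[a, b[) t = (b ^+ 2 - a ^+ 2) / 2.
Proof.
move=> ab.
have ci : {within `[a, b], continuous (fun t : R => t)}.
  by apply: continuous_subspaceT => x; exact: cvg_id.
have ii : mu.-integrable `[a, b] (EFin \o (fun t : R => t)).
  by apply: continuous_compact_integrable => //; exact: segment_compact.
rewrite Rintegral_itv_bndo_bndc; last first.
  apply: integrableS ii; [exact: measurable_itv|exact: measurable_itv|].
  by move=> x /=; rewrite !in_itv/= => /andP[->] /ltW.
pose F (x : R) := x ^+ 2 / 2.
have dF (x : R) : is_derive x 1 F x.
  rewrite /F; apply: is_derive_eq.
  by rewrite /GRing.scale/=; lra.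
have cF : continuous (F : R -> R).
  by move=> x; apply/differentiable_continuous/derivable1_diffP; case: (dF x).
rewrite /Rintegral (@continuous_FTC2 _ (fun t => t) F)//.
- by rewrite /F/= mulrBl.
- split.
  + by move=> x _; case: (dF x).
  + exact/cvg_at_right_filter/cF.
  + exact/cvg_at_left_filter/cF.
- by move=> x _; rewrite derive1E; case: (dF x).
Qed.

Lemma integrable_id01 : mu.-integrable `[0%R, 1%R[ (EFin \o (fun t : R => t)).
Proof.
apply: measurable_bounded_integrable => //.
  by rewrite /= lebesgue_measure_itv/= lte_fin ltr01 oppr0 adde0 ltry.
exists 1; split=> // M M1 t /=; rewrite in_itv/= => /andP[t0 t1].
by rewrite ger0_norm// (le_trans (ltW t1))// ltW.
Qed.

(** With h = 2^-(j+1) half the length of the support, the right half is the left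
    half translated by h, so the difference of the two integrals of t is - h * h. *)
Lemma integral_id_haar1 j m : (m < 2 ^ j)%N ->
  \int[mu]_(t in `[0%R, 1%R[) (t * haar1 j m t) = - (4 ^- j.+1).
Proof.
move=> mj; rewrite (integral_haar1 mj integrable_id01).2.
have [_ -> ->] := haar_itv_bisect j m.
have h0 : 0 < (2 ^+ j.+1 : R)^-1 by rewrite invr_gt0 exprn_gt0.
rewrite !Rintegral_id ?ltrDl//.
have -> : (4 ^- j.+1 : R) = (2 ^+ j.+1)^-1 ^+ 2.
  by rewrite exprVn -exprM mulnC exprM expr2 -natrM.
set h := (_ ^+ j.+1)^-1; set a := m%:R / _; by field.
Qed.

Lemma integrable_ray (z : R) :
  mu.-integrable `[0%R, 1%R[ (EFin \o \1_(`]z, +oo[ : set R)).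
Proof.
apply: measurable_bounded_integrable => //.
  by rewrite /= lebesgue_measure_itv/= lte_fin ltr01 oppr0 adde0 ltry.
exists 1; split=> // M M1 t _ /=.
by rewrite indicE; case: (_ \in _); rewrite ?normr1 ?normr0 ltW// (lt_trans ltr01).
Qed.

(** In one variable, the part of the discrepancy due to a point with coordinate z
    is the indicator of t > z; when z lies outside the support of a Haar function
    this indicator is 1 on the support if z is to its left and 0 if z is to its
    right. *)
Lemma integral_ray_haar1 j m (z : R) : (m < 2 ^ j)%N -> ~ @haar_itv R j m z ->
  \int[mu]_(t in `[0%R, 1%R[) (\1_(`]z, +oo[ : set R) t * haar1 j m t) = 0.
Proof.
move=> mj; rewrite /haar_itv /= in_itv/= => /negP; rewrite negb_and -ltNge -leNgt.
case/orP => zm.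
  apply: (@integral_haar1_cst _ _ _ 1 mj (integrable_ray z)) => t.
  rewrite /haar_itv /= in_itv/= => /andP[mt _]; rewrite indicE mem_set//=.
  by rewrite in_itv/= andbT (lt_le_trans zm).
apply: (@integral_haar1_cst _ _ _ 0 mj (integrable_ray z)) => t.
rewrite /haar_itv /= in_itv/= => /andP[_ tm]; rewrite indicE memNset//=.
by rewrite in_itv/= andbT; apply/negP; rewrite -leNgt (le_trans (ltW tm)).
Qed.

End haar1D.

(** * Haar coefficients of the discrepancy on boxes without points *)

Lemma Rintegral_sum d (T : measurableType d) (R : realType)
    (mu : {measure set T -> \bar R}) (D : set T) (I : eqType) (s : seq I)
    (F : I -> T -> R) : measurable D ->
  (forall i, i \in s -> mu.-integrable D (EFin \o F i)) ->
  mu.-integrable D (EFin \o (fun x => \sum_(i <- s) F i x)) /\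
  \int[mu]_(x in D) (\sum_(i <- s) F i x) =
  \sum_(i <- s) \int[mu]_(x in D) F i x.
Proof.
move=> mD; elim: s => [|a s IH] Fi.
  have E : (fun x => \sum_(i <- [::]) F i x) = cst 0.
    by apply/funext => x; rewrite big_nil.
  rewrite big_nil E; split; first exact: integrable0.
  by rewrite Rintegral_cst// mul0r.
have [|si sE] := IH; first by move=> i is_; apply: Fi; rewrite in_cons is_ orbT.
have ai := Fi a (mem_head a s).
have E : (fun x => \sum_(i <- a :: s) F i x) =
    (fun x => F a x + \sum_(i <- s) F i x).
  by apply/funext => x; rewrite big_cons.
rewrite E; split; first exact: (integrableD mD ai si).
by rewrite RintegralD// sE big_cons.
Qed.

Section empty_box.
Variables (R : realType) (d : nat).
Implicit Types (x z : euclid R d) (j m : d.-tuple nat) (P : {fset euclid R d}).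
Local Notation vol := (lebesgue_euclid R d).

(** The condition that z lies in [0,x) is read here as a condition on x, since
    the coefficients are integrals over x; points of the cube satisfy the lower
    bounds automatically, so only the strict inequalities z_i < x_i remain. *)
Lemma indic_corner_box x z : unit_cube z ->
  \1_(corner_box x) z = \prod_(i < d) (\1_(`]tnth z i, +oo[ : set R) (tnth x i) : R).
Proof.
move=> zU; have [zx|zx] := pselect (corner_box x z).
  rewrite indicE mem_set// big1// => i _; rewrite indicE mem_set//=.
  by have /= := zx i; rewrite !in_itv/= andbT => /andP[].
rewrite indicE memNset//; have /existsNP[i zxi] := zx.
rewrite (bigD1 i)//= indicE memNset ?mul0r//= => xi; apply: zxi => /=.
have /= := zU i; move: xi.
by rewrite !in_itv/= andbT => -> /andP[->].
Qed.

(** A point outside the box is outside it in some coordinate, and the factor of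
    its counting integral at that coordinate vanishes; only the volume term
    survives. *)
Lemma inner_cube_empty_box P j m : dyadic_index j m ->
  (forall z, z \in P -> unit_cube z) ->
  (forall z, z \in P -> ~ dyadic_box j m z) ->
  inner_cube (discrepancy P) (haar j m) =
  - (#|` P|%fset%:R * \prod_(i < d) (- (4 ^- (tnth j i).+1))).
Proof.
move=> jm PU Pbox.
pose F z x : R := \prod_(i < d)
  (\1_(`]tnth z i, +oo[ : set R) (tnth x i) * haar1 (tnth j i) (tnth m i) (tnth x i)).
pose G x : R := \prod_(i < d) ((tnth x i : R) * haar1 (tnth j i) (tnth m i) (tnth x i)).
have FP z : z \in (P : seq _) -> vol.-integrable (@unit_cube R d) (EFin \o F z) /\
    \int[vol]_(x in @unit_cube R d) F z x = 0.
  move=> zP; have [] := @integrable_cube_prod R d (fun i t =>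
    \1_(`]tnth z i, +oo[ : set R) t * haar1 (tnth j i) (tnth m i) t).
    by move=> i; apply: (integral_haar1 (jm i) (integrable_ray _)).1.
  move=> Fi FE; split=> //; rewrite FE.
  have /existsNP[i zi] := Pbox z zP.
  by rewrite (bigD1 i)//= integral_ray_haar1 ?mul0r//; exact: jm.
have [Gi GE] : vol.-integrable (@unit_cube R d) (EFin \o G) /\
    \int[vol]_(x in @unit_cube R d) G x = \prod_(i < d) (- (4 ^- (tnth j i).+1)).
  have [] := @integrable_cube_prod R d (fun i t =>
    t * haar1 (tnth j i) (tnth m i) t).
    by move=> i; apply: (integral_haar1 (jm i) (@integrable_id01 R)).1.
  move=> Gi GE; split=> //; rewrite GE.
  by apply: eq_bigr => i _; rewrite integral_id_haar1//; exact: jm.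
have mU := @measurable_unit_cube R d.
have [Si SE] := Rintegral_sum mU (fun z zP => (FP z zP).1).
rewrite big_seq big1 in SE; last by move=> z zP; exact: (FP z zP).2.
set N : R := #|` P|%fset%:R.
have NGi : vol.-integrable (@unit_cube R d) (EFin \o (fun x => N * G x)).
  exact: (integrableZl mU N Gi).
transitivity (\int[vol]_(x in @unit_cube R d) (\sum_(z <- P) F z x - N * G x)).
  apply: eq_Rintegral => x _; rewrite /discrepancy mulrBl; congr (_ - _).
    rewrite mulr_suml; apply: eq_big_seq => z zP.
    rewrite indic_corner_box; last exact: PU.
    by symmetry; apply: big_split.
  by rewrite -mulrA; congr (_ * _); symmetry; apply: big_split.
by rewrite RintegralB// SE RintegralZl// GE sub0r.
Qed.

Lemma inner_cube_empty_box_sqr P j m : dyadic_index j m ->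
  (forall z, z \in P -> unit_cube z) ->
  (forall z, z \in P -> ~ dyadic_box j m z) ->
  `|inner_cube (discrepancy P) (haar j m)| ^+ 2 =
  #|` P|%fset%:R ^+ 2 * 16 ^- (\sum_(i < d) tnth j i + d).
Proof.
move=> jm PU Pbox; rewrite inner_cube_empty_box// real_normK ?num_real//.
rewrite sqrrN exprMn -prodrXl; congr (_ * _).
have -> : (\sum_(i < d) tnth j i + d = \sum_(i < d) (tnth j i).+1)%N.
  under [RHS]eq_bigr do rewrite -addn1.
  by rewrite big_split/= sum1_card card_ord.
rewrite -exprVn -prodrXr; apply: eq_bigr => i _.
by rewrite sqrrN -!exprVn exprAC expr2 -invfM -natrM.
Qed.

End empty_box.

(** * Counting boxes without points *)

(** Each element of s can account for at most one index m. *)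
Lemma card_has_le (T : finType) (I : Type) (r : T -> I -> bool) (s : seq I) :
  (forall z m m', r m z -> r m' z -> m = m') ->
  (#|[set m | has (r m) s]%SET| <= size s)%N.
Proof.
move=> r1; elim: s => [|a s IH] /=.
  by rewrite (_ : [set m | false]%SET = finset.set0) ?cards0//;
    apply/setP => m; rewrite !inE.
rewrite (_ : [set m | _] = [set m | r m a] :|: [set m | has (r m) s])%SET; last first.
  by apply/setP => m; rewrite !inE.
rewrite (leq_trans (leq_card_setU _ _))// -addn1 addnC leq_add//.
by apply/card_le1_eqP => m m'; rewrite !inE => ma m'a; exact: r1 m'a ma.
Qed.

(** An unordered sum is a supremum over finite subsets, and the injection e turns
    a set of finite type into one of these: this is how the two nested sums in
    the norm are reduced to finite ones. *)
Lemma sum_le_esum (R : realType) (T : finType) (I : choiceType) (S : set I)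
    (a : I -> \bar R) (e : T -> I) (A : {set T}) : injective e ->
  (forall t, t \in A -> S (e t)) ->
  (\sum_(t in A) a (e t) <= \esum_(i in S) a i)%E.
Proof.
move=> einj AS; apply: esum_ge.
exists [set` [seq e t | t in A]].
  split; first exact: finite_seq.
  by move=> i /= /mapP[t]; rewrite mem_enum => tA ->; exact: AS.
rewrite -fsbig_seq; first by rewrite big_image.
by rewrite map_inj_uniq// enum_uniq.
Qed.

Section free_boxes.
Variables (R : realType) (d : nat).
Implicit Types (j m : d.-tuple nat) (P : {fset euclid R d}).

Lemma haar_itv_inj (j m m' : nat) (t : R) :
  haar_itv j m t -> haar_itv j m' t -> m = m'.
Proof.
rewrite /haar_itv /= !in_itv/= => /andP[mt tm] /andP[m't tm'].
have le p q : p%:R / 2 ^+ j <= t -> t < q.+1%:R / 2 ^+ j -> (p <= q)%N.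
  move=> pt tq; have := le_lt_trans pt tq.
  by rewrite ltr_pM2r ?invr_gt0 ?exprn_gt0// ltr_nat ltnS.
by apply/eqP; rewrite eqn_leq (le _ _ mt tm') (le _ _ m't tm).
Qed.

(** The dyadic index set of shape j is parametrized by a finite type of dependent
    functions, so that its cardinality is a product of powers of two. *)
Definition box_index j (m : {dffun forall i : 'I_d, 'I_(2 ^ tnth j i)}) :
  d.-tuple nat := [tuple (m i : nat) | i < d].

Lemma box_index_inj j : injective (@box_index j).
Proof.
move=> m m' mm'; apply/ffunP => i; apply/val_inj.
by have := congr1 (fun t => tnth t i) mm'; rewrite !tnth_mktuple.
Qed.

Lemma dyadic_index_box_index j u : dyadic_index j (@box_index j u).
Proof. by move=> i; rewrite tnth_mktuple. Qed.

Lemma dyadic_box_sub_cube j m : dyadic_index j m ->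
  dyadic_box j m `<=` @unit_cube R d.
Proof. by move=> jm x xm i; apply: haar_itv_sub01 (jm i) _ (xm i). Qed.

(** Boxes of the same shape are disjoint, so each point occupies at most one of
    the 2^|j| boxes. *)
Lemma card_free_boxes P j :
  (2 ^ (\sum_(i < d) tnth j i) <=
   #|[set u | ~~ has (fun z => `[<dyadic_box j (@box_index j u) z>]) P]%SET|
   + #|` P|%fset)%N.
Proof.
set A := [set u | _]%SET.
have -> : (2 ^ (\sum_(i < d) tnth j i) =
    #|{dffun forall i : 'I_d, 'I_(2 ^ tnth j i)}|)%N.
  rewrite card_dep_ffun foldrE big_map big_enum/= expn_sum.
  by apply: eq_bigr => i _; rewrite card_ord.
rewrite -(cardsC A) leq_add2l.
rewrite (_ : ~: A =
  [set u | has (fun z => `[<dyadic_box j (@box_index j u) z>]) P])%SET; last first.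
  by apply/setP => u; rewrite !inE negbK.
apply: card_has_le => z u u' /asboolP zu /asboolP zu'.
apply: box_index_inj; apply: eq_from_tnth => i.
exact: haar_itv_inj (zu i) (zu' i).
Qed.

(** When 2^|j| is at least 2N, at least 2^|j| / 2 boxes are free, each with squared
    coefficient N^2 16^-(|j|+d); when it is at most 4N, the number N^2 / 4^|j|
    is at least 1/16. The powers of 2^|j| cancel and leave a bound independent
    of j and N. *)
Lemma esum_shape_ge P j :
  (forall z, z \in P -> unit_cube z) ->
  (2 * #|` P|%fset <= 2 ^ (\sum_(i < d) tnth j i) <= 4 * #|` P|%fset)%N ->
  ((32 * 16 ^+ d)^-1%:E <= (2 ^+ (\sum_(i < d) tnth j i)%N)%:E *
   \esum_(m in [set m | dyadic_index j m /\ dyadic_box j m `<=` @unit_cube R d])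
      (`|inner_cube (discrepancy P) (haar j m)| ^+ 2)%:E)%E.
Proof.
set n := (\sum_(i < d) tnth j i)%N; set N := #|` P|%fset => PU /andP[Nn nN].
pose A : {set {dffun forall i : 'I_d, 'I_(2 ^ tnth j i)}} :=
  [set u | ~~ has (fun z => `[<dyadic_box j (@box_index j u) z>]) P]%SET.
pose v : R := N%:R ^+ 2 * 16 ^- (n + d).
have Av : ((#|A|%:R * v)%:E <=
    \esum_(m in [set m | dyadic_index j m /\ dyadic_box j m `<=` @unit_cube R d])
      (`|inner_cube (discrepancy P) (haar j m)| ^+ 2)%:E)%E.
  apply: le_trans (sum_le_esum (fun m =>
     (`|inner_cube (discrepancy P) (haar j m)| ^+ 2)%:E) (@box_index_inj j) (A := A) _).
    under eq_bigr => m.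
      rewrite inE => /hasPn mA.
      rewrite (inner_cube_empty_box_sqr (@dyadic_index_box_index j m) PU); last first.
        by move=> z /mA /asboolPn.
      over.
    by rewrite sumEFin lee_fin big_const iter_addr_0 mulr_natl.
  move=> m _; split; first exact: dyadic_index_box_index.
  exact/dyadic_box_sub_cube/dyadic_index_box_index.
apply: le_trans (lee_wpmul2l _ Av); last by rewrite lee_fin exprn_ge0.
rewrite -EFinM lee_fin.
have h0 : 0 < (2 ^+ n : R) by rewrite exprn_gt0.
have An : 2 ^+ n / 2 <= (#|A|%:R : R).
  have := card_free_boxes P j; rewrite -/n -/N -/A => An.
  rewrite ler_pdivrMr// -natrX -natrM ler_nat.
  by move: An Nn; clear; move: #|A| (2 ^ n)%N N => a b c; lia.
have {}nN : 2 ^+ n / 4 <= (N%:R : R).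
  by rewrite ler_pdivrMr// -natrX -natrM ler_nat mulnC.
(* The right-hand side puts 2^n / 2 for the number of free boxes and 2^n / 4
   for N, their respective lower bounds. *)
have E : (32 * 16 ^+ d)^-1 =
    2 ^+ n * (2 ^+ n / 2 * ((2 ^+ n / 4) ^+ 2 * 16 ^- (n + d))) :> R.
  have -> : (16 ^- (n + d) : R) = (2 ^+ n)^-1 ^+ 4 * 16 ^- d.
    rewrite exprD invfM; congr (_ * _).
    by rewrite exprVn -exprM mulnC exprM -[2 ^+ 4]natrX.
  by field; rewrite ?expf_neq0// lt0r_neq0.
rewrite E ler_wpM2l ?(ltW h0)// ler_pM//.
rewrite /v ler_wpM2r ?invr_ge0 ?exprn_ge0//.
by rewrite lerXn2r ?nnegrE ?divr_ge0// ltW.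
Qed.

End free_boxes.

(** * Summation over the shapes of one scale *)

Lemma bin_ge_powX (k n : nat) : (n ^ k <= 'C(k + n, k) * k`!)%N.
Proof.
rewrite bin_ffact; elim: k => [|k IH]; first by rewrite expn0 ffactn0.
rewrite addSn ffactSS expnS leq_mul//.
by rewrite -addSn leq_addl.
Qed.

Lemma ln_le_pow2 (R : realType) (N n : nat) : (0 < N)%N -> (N <= 2 ^ n)%N ->
  ln (N%:R : R) <= n%:R.
Proof.
move=> N0 Nn; apply: (@le_trans _ _ (ln (2 ^+ n))).
  by rewrite ler_ln ?posrE ?ltr0n ?exprn_gt0// -natrX ler_nat.
rewrite lnXn// ler_wMn2r//.
by have := @le_ln1Dx R 1; rewrite -natr1; apply; lra.
Qed.

(** The shapes j with |j| = n are the weak compositions of n into k+1 parts; there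
    are C(k+n, k) of them, and the bound on their contributions does not depend
    on j. *)
Lemma bmo_at_cube_ge (R : realType) k n (P : {fset euclid R k.+1}) :
  (forall z, z \in P -> unit_cube z) ->
  (2 * #|` P|%fset <= 2 ^ n <= 4 * #|` P|%fset)%N ->
  ((('C(k + n, k)%:R / (32 * 16 ^+ k.+1)) `^ 2^-1)%:E <=
   bmo_at (discrepancy P) (@unit_cube R k.+1))%E.
Proof.
move=> PU Nn; rewrite /bmo_at -poweR_EFin lebesgue_unit_cube inve1 mul1e.
apply: gt0_ler_poweR => //.
- by rewrite in_itv/= leey andbT lee_fin divr_ge0// mulr_ge0// exprn_ge0.
- rewrite in_itv/= leey andbT; apply: esum_ge0 => j _; apply: mule_ge0.
    by rewrite lee_fin exprn_ge0.
  by apply: esum_ge0 => m _; rewrite lee_fin exprn_ge0.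
pose shape (t : k.+1.-tuple 'I_n.+1) : k.+1.-tuple nat := [tuple of map val t].
have shape_inj : injective shape.
  move=> t t' /(congr1 val)/= tt'; apply/val_inj.
  exact: inj_map val_inj _ _ tt'.
have shape_sum t : (\sum_(i < k.+1) tnth (shape t) i = \sum_(i <- t) i)%N.
  by rewrite big_tuple; apply: eq_bigr => i _; rewrite tnth_map.
pose A : {set k.+1.-tuple 'I_n.+1} :=
  [set t : k.+1.-tuple 'I_n.+1 | (\sum_(i <- t) i == n)%N]%SET.
have {}shape_sum t : t \in A -> (\sum_(i < k.+1) tnth (shape t) i = n)%N.
  by rewrite inE shape_sum => /eqP.
apply: le_trans; last exact: (sum_le_esum _ shape_inj (A := A) (fun _ _ => I)).
rewrite -card_ord_partitions -/A mulr_natl.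
apply: (@le_trans _ _ (\sum_(t in A) (32 * 16 ^+ k.+1)^-1%:E)%E).
  by rewrite sumEFin lee_fin big_const iter_addr_0.
apply: lee_sum => t tA.
by apply: esum_shape_ge => //; rewrite shape_sum.
Qed.

Theorem theorem1p2 (R : realType) (d : nat) (hd : (3 <= d)%N) :
  exists c : R, 0 < c /\
    forall N : nat, (0 < N)%N ->
    forall P : {fset euclid R d},
      #|` P|%fset = N ->
      (forall z, z \in P -> unit_cube z) ->
      ((c * ln (N%:R : R) `^ ((d%:R - 1) / 2))%:E
         <= bmo_norm (discrepancy P))%E.
Proof.
case: d hd => // k _.
pose a : R := (k`!%:R * (32 * 16 ^+ k.+1))^-1.
have a0 : 0 < a by rewrite invr_gt0 mulr_gt0 ?ltr0n ?fact_gt0// mulr_gt0// exprn_gt0.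
exists (a `^ 2^-1); split; first exact: powR_gt0.
move=> N N0 P PN PU.
(* The scale at which N lies between a quarter and a half of 2^n. *)
pose n := (trunc_log 2 N).+2.
have /andP[Nlo Nhi] := trunc_log_bounds (isT : 1 < 2)%N N0.
have Nn : (2 * N <= 2 ^ n <= 4 * N)%N.
  by rewrite /n !expnS in Nhi *; apply/andP; split; lia.
apply: (@le_trans _ _ (bmo_at (discrepancy P) (@unit_cube R k.+1))); last first.
  apply: ereal_sup_ubound; exists (@unit_cube R k.+1) => //; split=> //.
    exact: measurable_unit_cube.
  by rewrite lebesgue_unit_cube lte_fin.
rewrite -PN in Nn; apply: le_trans (bmo_at_cube_ge PU Nn); rewrite lee_fin.
have lnN0 : 0 <= ln (N%:R : R) by rewrite ln_ge0// ler1n.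
have -> : (k.+1%:R - 1) / 2 = k%:R * 2^-1 :> R by rewrite -natr1 addrK.
rewrite powRrM powR_mulrn// -powRM; [|exact: ltW|exact: exprn_ge0].
apply: ge0_ler_powR; rewrite ?nnegrE ?invr_ge0//.
  by rewrite mulr_ge0 ?exprn_ge0// ltW.
rewrite /a invfM mulrAC ler_pM2r ?invr_gt0 ?mulr_gt0 ?exprn_gt0//.
rewrite mulrC ler_pdivrMr ?ltr0n ?fact_gt0// -natrM.
apply: le_trans (_ : (n ^ k)%:R <= _); last by rewrite ler_nat bin_ge_powX.
rewrite natrX lerXn2r ?nnegrE//; apply: ln_le_pow2 => //.
by move: Nn; rewrite PN => /andP[+ _]; lia.
Qed.
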